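(* Let $(B^n,g_B)$ be a compact Riemannian manifold of dimension $n\ge 2$. Let $m\ge 1$, let $s_1,\dots,s_m$ be positive integers, let $\lambda\in\mathbb{R}$ be a constant, and let $b_1,\dots,b_m$ be non-constant smooth positive functions on $B$ satisfying $$\mathrm{Ric}_B=\lambda g_B+\sum_{i=1}^m\frac{s_i}{b_i}H_B^{b_i}.$$ Then $b_1,\dots,b_m$ satisfy the following identity of $1$-forms on $B$: $$\sum_{k=1}^m\frac{s_k}{2b_k^2}\,d\Big\{\sum_{j=1}^m s_j\frac{b_k}{b_j}\,g_B(\mathrm{grad}_B b_k,\mathrm{grad}_B b_j)+b_k\Delta_B b_k-\|\mathrm{grad}_B b_k\|_B^2+\lambda b_k^2\Big\}=0.$$
   Context: $\mathrm{Ric}_B$ is the Ricci tensor of $(B,g_B)$ (with the sign for which round spheres have positive Ricci curvature). For $f\in C^\infty(B)$, $\mathrm{grad}_B f$ is the $g_B$-gradient, $H_B^f(X,Y)=XYf-(\nabla^B_XY)f$ is the Hessian, $\Delta_B f$ is the $g_B$-trace of $H_B^f$, and $\|\mathrm{grad}_B f\|_B^2=g_B(\mathrm{grad}_B f,\mathrm{grad}_B f)$. $d$ is the exterior derivative of functions. *)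

(* Defs.v *)
From HB Require Import structures.
From mathcomp Require Import all_boot all_order all_algebra.
From mathcomp Require Import all_classical all_reals all_analysis.
Set Implicit Arguments.
Unset Strict Implicit.
Unset Printing Implicit Defensive.
Import Order.TTheory GRing.Theory Num.Theory.
Import numFieldNormedType.Exports.
Local Open Scope classical_set_scope.
Local Open Scope ring_scope.

(** * Smooth maps on open subsets of R^n *)

Section SmoothMaps.
Context {R : realType} {n : nat}.

Definition basis_vec (a : 'I_n) : 'rV[R]_n := delta_mx 0 a.

(* Only meaningful for [U] open: then [f] is defined near each point of [U], so
   two-sided derivatives and unrestricted continuity are the right notions. *)
Fixpoint Ck {V : normedModType R} (k : nat) (U : set 'rV[R]_n)
    (f : 'rV[R]_n -> V) : Prop :=
  (forall x, U x -> {for x, continuous f}) /\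
  match k with
  | 0%N => True
  | k'.+1 => forall a : 'I_n,
      (forall x, U x -> derivable f x (basis_vec a)) /\
      Ck k' U ('D_(basis_vec a) f)
  end.

Definition smooth_on {V : normedModType R} (U : set 'rV[R]_n)
    (f : 'rV[R]_n -> V) : Prop := forall k, Ck k U f.

End SmoothMaps.

(** * Riemannian geometry of a metric given in coordinates

    [G x] is the Gram matrix of the metric at [x] in the coordinate frame, and
    vector fields are identified with their component functions.  Tensors are
    evaluated on tangent vectors by extending these to constant vector fields,
    the result being independent of the extension. *)

Section LocalGeometry.
Context {R : realType} {n : nat}.
Variable G : 'rV[R]_n -> 'M[R]_n.
Implicit Types (X Y Z : 'rV[R]_n -> 'rV[R]_n) (f : 'rV[R]_n -> R).
Implicit Types (x u v : 'rV[R]_n).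

Definition loc_ip x u v : R := (u *m G x *m v^T) 0 0.

(* The function X f. *)
Definition vf_apply X f : 'rV[R]_n -> R := fun x => 'D_(X x) f x.

Definition lie_bracket X Y : 'rV[R]_n -> 'rV[R]_n :=
  fun x => 'D_(X x) Y x - 'D_(Y x) X x.

(* Gamma^k_{ij} *)
Definition christoffel x (i j k : 'I_n) : R :=
  2^-1 * \sum_(l < n) invmx (G x) k l *
    ('D_(basis_vec i) (fun y => G y j l : R) x +
     'D_(basis_vec j) (fun y => G y i l : R) x -
     'D_(basis_vec l) (fun y => G y i j : R) x).

(* Levi-Civita connection. *)
Definition nabla X Y : 'rV[R]_n -> 'rV[R]_n := fun x =>
  'D_(X x) Y x +
  \row_(k < n) \sum_(i < n) \sum_(j < n) X x 0 i * Y x 0 j * christoffel x i j k.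

Definition curvature X Y Z : 'rV[R]_n -> 'rV[R]_n := fun x =>
  nabla X (nabla Y Z) x - nabla Y (nabla X Z) x - nabla (lie_bracket X Y) Z x.

(* Trace of w |-> R(w, u) v; equal to (n - 1) g on the unit round sphere. *)
Definition loc_ricci x u v : R :=
  \sum_(a < n) curvature (cst (basis_vec a)) (cst u) (cst v) x 0 a.

(* The vector with g(grad f, v) = df(v) for all v. *)
Definition loc_grad f : 'rV[R]_n -> 'rV[R]_n := fun x =>
  (\row_(a < n) 'D_(basis_vec a) f x) *m invmx (G x).

Definition loc_hess f x u v : R :=
  vf_apply (cst u) (vf_apply (cst v) f) x -
  vf_apply (nabla (cst u) (cst v)) f x.

Definition loc_laplacian f x : R :=
  \sum_(a < n) \sum_(a' < n)
    invmx (G x) a a' * loc_hess f x (basis_vec a) (basis_vec a').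

End LocalGeometry.

(** * Smooth manifolds and Riemannian metrics *)

Record chart (R : realType) (n : nat) (B : topologicalType) := Chart {
  chart_dom : set B;
  chart_map :> B -> 'rV[R]_n;
  chart_inv : 'rV[R]_n -> B;
  chart_dom_open : open chart_dom;
  chart_img_open : open (chart_map @` chart_dom);
  chart_mapK : forall p, chart_dom p -> chart_inv (chart_map p) = p;
  chart_map_continuous :
    forall p, chart_dom p -> {for p, continuous chart_map};
  chart_inv_continuous :
    forall x, (chart_map @` chart_dom) x -> {for x, continuous chart_inv} }.

Definition chart_img (R : realType) (n : nat) (B : topologicalType)
  (c : chart R n B) : set 'rV[R]_n := c @` chart_dom c.

Definition transition (R : realType) (n : nat) (B : topologicalType)
  (c c' : chart R n B) : 'rV[R]_n -> 'rV[R]_n := c' \o chart_inv c.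

(* Without boundary and not necessarily connected. *)
Record smoothManifold (R : realType) (n : nat) := SmoothManifold {
  manifold_space :> topologicalType;
  manifold_hausdorff : hausdorff_space manifold_space;
  manifold_second_countable : @second_countable manifold_space;
  atlas : set (chart R n manifold_space);
  atlas_cover : forall p, exists2 c, atlas c & chart_dom c p;
  atlas_smooth : forall c c', atlas c -> atlas c' ->
    smooth_on (c @` (chart_dom c `&` chart_dom c')) (transition c c') }.

Definition smooth_fun (R : realType) (n : nat) (B : smoothManifold R n)
  (f : B -> R) : Prop :=
  forall c, atlas c -> smooth_on (chart_img c) (f \o chart_inv c : _ -> R).

(* A smooth symmetric positive definite (0,2)-tensor field, given by its
   matrices of components in the charts of the atlas. *)
Record riemannianMetric (R : realType) (n : nat) (B : smoothManifold R n) :=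
  RiemannianMetric {
  metric_mx :> chart R n B -> 'rV[R]_n -> 'M[R]_n;
  metric_smooth : forall c, atlas c -> smooth_on (chart_img c) (metric_mx c);
  metric_sym : forall c, atlas c -> forall x, chart_img c x ->
    forall u v, loc_ip (metric_mx c) x u v = loc_ip (metric_mx c) x v u;
  metric_pos : forall c, atlas c -> forall x, chart_img c x ->
    forall v, v != 0 -> 0 < loc_ip (metric_mx c) x v v;
  metric_compat : forall c c', atlas c -> atlas c' ->
    forall p, chart_dom c p -> chart_dom c' p -> forall u v,
    loc_ip (metric_mx c) (c p) u v =
    loc_ip (metric_mx c') (c' p)
      ('D_u (transition c c') (c p)) ('D_v (transition c c') (c p)) }.

(** * Tensor calculus on a Riemannian manifold

    Tangent vectors at a point [p] of the domain of a chart [c] are given by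
    their components in [c], so the operations below take [c] as an argument;
    the scalars [inner], [laplacian] and so on do not depend on it as long as
    [p] is in the domain of [c].  An identity of tensor fields is the identity
    of their components in every chart of the atlas. *)

Section ManifoldCalculus.
Context {R : realType} {n : nat} {B : smoothManifold R n}.
Variables (g : riemannianMetric B) (c : chart R n B).
Implicit Types (f : B -> R) (p : B) (u v : 'rV[R]_n).

Definition inner p u v : R := loc_ip (g c) (c p) u v.

Definition ricci p u v : R := loc_ricci (g c) (c p) u v.

Definition grad f p : 'rV[R]_n := loc_grad (g c) (f \o chart_inv c) (c p).

Definition hess f p u v : R := loc_hess (g c) (f \o chart_inv c) (c p) u v.

Definition laplacian f p : R := loc_laplacian (g c) (f \o chart_inv c) (c p).

Definition ext_d f p v : R := 'D_v (f \o chart_inv c : _ -> R) (c p).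

End ManifoldCalculus.

(* Main.v *)
Require Import Defs.
From HB Require Import structures.
From mathcomp Require Import all_boot all_order all_algebra.
From mathcomp Require Import all_classical all_reals all_analysis.
From mathcomp Require Import ring.
Set Implicit Arguments.
Unset Strict Implicit.
Unset Printing Implicit Defensive.
Import Order.TTheory GRing.Theory Num.Theory.
Import numFieldNormedType.Exports.
Local Open Scope classical_set_scope.
Local Open Scope ring_scope.

(** The hypothesis on the Ricci tensor is differentiated, and the contracted
    second Bianchi identity [contracted_bianchi], dS = 2 div Ric with S the
    scalar curvature, turns the result into a relation between the b_k alone.
    Write H_k for the Hessian of b_k with one index raised, u_k for the
    differential db_k and t_k = tr H_k for the Laplacian.  Three facts are
    needed:
    - div (f T) = T df + f div T;
    - div H_k = Ric u_k + dt_k, the Bochner formula [divergence_hessian], where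
      Ric u_k is in turn expressed by the hypothesis;
    - d<grad b_k, grad b_j> = H_k u_j + H_j u_k, which is [D_grad_ip].

    Taking the trace and the divergence of
    Ric = lambda + sum_k (s_k / b_k) H_k
    and substituting in dS = 2 div Ric yields
    sum_k s_k (- d|grad b_k|^2 / b_k^2 + 2 lambda u_k / b_k + dt_k / b_k
    + t_k u_k / b_k^2 + 2 sum_j (s_j / (b_k b_j)) H_j u_k) = 0.
    Up to a factor 1/2, this differs from the claimed identity only by a double
    sum over k and j of terms that are antisymmetric in k and j, hence by 0: in
    the double sum on the left H_j u_k may be symmetrized into half of
    d<grad b_k, grad b_j>, and the contributions of d(b_k / b_j) to the claim
    cancel in pairs.  This is [quasi_einstein_identity].

    The statement being local, everything takes place in one chart, whose image
    is an open set U of R^n.  The geometry is pure algebra in the ring of smooth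
    functions on U with its commuting derivations, the partial derivatives:
    the metric, its inverse, the Christoffel symbols and the curvature are
    matrices over this ring, and each covariant derivative is a matrix
    expression, so that the Bianchi identity becomes a Jacobi identity between
    matrices.  The analysis is confined to two facts about functions with
    continuous partial derivatives: directional derivatives are linear in the
    direction [is_derive_basis], and partial derivatives commute [schwarz].
    Both follow from the mean value theorem on segments. *)

(** * Riemannian geometry over a differential ring *)

Lemma addmxE (S : nzRingType) m n (M N : 'M[S]_(m, n)) i j :
  (M + N) i j = M i j + N i j.
Proof. by rewrite mxE. Qed.

Lemma oppmxE (S : nzRingType) m n (M : 'M[S]_(m, n)) i j :
  (- M) i j = - M i j.
Proof. by rewrite mxE. Qed.

Lemma zeromxE (S : nzRingType) m n i j : (0 : 'M[S]_(m, n)) i j = 0.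
Proof. by rewrite mxE. Qed.

(* Identities between matrices hold entrywise, products of matrices being
   treated as atoms once sums are distributed out of them. *)
Ltac mx_ring :=
  rewrite ?(mulmxDl, mulmxDr, mulNmx, mulmxN, mulmxA);
  let i := fresh in let j := fresh in
  apply/matrixP => i j; rewrite ?(addmxE, oppmxE, zeromxE); ring.

Section DifferentialRing.
(** [D i] stands for the i-th partial derivative on a ring of functions. *)
Variables (S : comNzRingType) (n : nat) (D : 'I_n -> {additive S -> S}).
Hypothesis DM : forall i f g, D i (f * g) = D i f * g + f * D i g.
Hypothesis DC : forall i j f, D i (D j f) = D j (D i f).

Local Notation d i := (map_mx (D i)).

Lemma D1 i : D i 1 = 0.
Proof.
have := DM i 1 1; rewrite !mulr1 mul1r => e.
by apply: (@addrI _ (D i 1)); rewrite addr0 -e.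
Qed.

Lemma Dnat i k : D i k%:R = 0.
Proof. by rewrite raddfMn D1 mul0rn. Qed.

Lemma d_mulmx i m p q (M : 'M[S]_(m, p)) (N : 'M[S]_(p, q)) :
  d i (M *m N) = d i M *m N + M *m d i N.
Proof.
apply/matrixP => a b; rewrite !mxE raddf_sum -big_split /=.
by apply: eq_bigr => c _; rewrite DM !mxE.
Qed.

Lemma d_tr i m p (M : 'M[S]_(m, p)) : d i (M^T) = (d i M)^T.
Proof. by rewrite map_trmx. Qed.

Lemma d_addmx i m p (M N : 'M[S]_(m, p)) : d i (M + N) = d i M + d i N.
Proof. exact: map_mxD. Qed.

Lemma d_oppmx i m p (M : 'M[S]_(m, p)) : d i (- M) = - d i M.
Proof. exact: map_mxN. Qed.

Lemma d_comm i j m p (M : 'M[S]_(m, p)) : d i (d j M) = d j (d i M).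
Proof. by apply/matrixP => a b; rewrite !mxE DC. Qed.

Lemma d_scalar i a : D i a = 0 -> d i (a%:M : 'M[S]_n) = 0.
Proof.
by move=> a0; apply/matrixP => k l; rewrite !mxE raddfMn a0 mul0rn.
Qed.

(** [G] is the Gram matrix of a metric and [Gi] its inverse.  Vector fields are
    rows, and [A i j k] is the Christoffel symbol Gamma^k_ij, so that the
    covariant derivative of [w] in the i-th direction is [d i w + w *m A i]. *)
Variables (G Gi : 'M[S]_n) (A : 'I_n -> 'M[S]_n).
Hypothesis G_sym : G^T = G.
Hypothesis GGi : G *m Gi = 1%:M.
Hypothesis GiG : Gi *m G = 1%:M.
Hypothesis torsion_free : forall i j k, A i j k = A j i k.
Hypothesis metric_conn : forall i, d i G = A i *m G + G *m (A i)^T.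

Lemma Gi_sym : Gi^T = Gi.
Proof.
by rewrite -[LHS]mulmx1 -GGi mulmxA -{1}G_sym -trmx_mul GGi trmx1 mul1mx.
Qed.

Lemma d_Gi i : d i Gi = - (Gi *m A i + (A i)^T *m Gi).
Proof.
have e : d i G *m Gi = - (G *m d i Gi).
  by apply/eqP; rewrite -addr_eq0 -d_mulmx GGi d_scalar ?D1.
rewrite -[LHS]mul1mx -GiG -mulmxA -[G *m _]opprK -e metric_conn.
rewrite mulmxN !mulmxDl -!mulmxA GGi mulmx1 mulmxDr (mulmxA Gi G) GiG.
by rewrite mul1mx.
Qed.

(** The endomorphism w |-> nabla_i nabla_j w - nabla_j nabla_i w, acting on rows
    from the right (see [cov_row_commute]). *)
Definition curvature_mx i j : 'M[S]_n :=
  d i (A j) - d j (A i) + A j *m A i - A i *m A j.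

(** Covariant derivative of an endomorphism: the row index of [M] is covariant
    and its column index contravariant. *)
Definition cov_mx i (M : 'M[S]_n) := d i M + M *m A i - A i *m M.

Lemma curvature_mxC i j : curvature_mx j i = - curvature_mx i j.
Proof. rewrite /curvature_mx; mx_ring. Qed.

(** The metric being parallel, the left-hand side is the commutator of the two
    derivatives [d i] and [d j] applied to [G]. *)
Lemma curvature_mx_metric i j :
  curvature_mx i j *m G + G *m (curvature_mx i j)^T = 0.
Proof.
have e := d_comm j i G; rewrite -(subrr (d i (d j G))) -{2}e.
rewrite !metric_conn !(d_addmx, d_mulmx) !d_tr !metric_conn /curvature_mx.
rewrite !(raddfB, raddfD) /= !trmx_mul; mx_ring.
Qed.

Lemma curvature_up_antisym i j :
  (Gi *m curvature_mx i j)^T = - (Gi *m curvature_mx i j).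
Proof.
have := congr1 (fun M => Gi *m M *m Gi) (curvature_mx_metric i j).
rewrite mulmxDr mulmxDl mulmx0 mul0mx !mulmxA GiG mul1mx.
rewrite -(mulmxA _ G Gi) GGi mulmx1 trmx_mul Gi_sym => /eqP.
by rewrite addr_eq0 -eqr_oppLR => /eqP.
Qed.

(** This is the Jacobi identity for the operators nabla_i, nabla_j, nabla_k:
    [curvature_mx j k] is a commutator, and [cov_mx i] is the commutator with
    nabla_i. *)
Lemma cov_mx_curvature_cyclic i j k :
  cov_mx i (curvature_mx j k) + cov_mx j (curvature_mx k i)
    + cov_mx k (curvature_mx i j) = 0.
Proof.
rewrite /cov_mx /curvature_mx !(d_addmx, d_oppmx, d_mulmx).
rewrite (d_comm j i) (d_comm k i) (d_comm k j); mx_ring.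
Qed.

(** Covariant derivative of the full curvature tensor: compared with [cov_mx],
    the indices [j] and [k] are differentiated as well. *)
Definition cov_curv i j k : 'M[S]_n :=
  cov_mx i (curvature_mx j k)
  - \sum_l A i j l *: curvature_mx l k - \sum_l A i k l *: curvature_mx j l.

(** The terms that distinguish [cov_curv] from [cov_mx] cancel in the cyclic sum
    because the connection is torsion free. *)
Lemma second_bianchi i j k :
  cov_curv i j k + cov_curv j k i + cov_curv k i j = 0.
Proof.
have flip i1 j1 k1 : \sum_l A i1 k1 l *: curvature_mx j1 l =
    - \sum_l A k1 i1 l *: curvature_mx l j1.
  rewrite -sumrN; apply: eq_bigr => l _.
  by rewrite torsion_free (curvature_mxC l) scalerN.
rewrite /cov_curv (flip i j k) (flip j k i) (flip k i j).
rewrite -[RHS](cov_mx_curvature_cyclic i j k); mx_ring.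
Qed.

Definition ricci_mx : 'M[S]_n := \matrix_(k, l) \sum_a curvature_mx a k l a.

Definition ricci_up : 'M[S]_n := ricci_mx *m Gi.

Lemma ricci_upE k b : ricci_up k b = \sum_a (Gi *m curvature_mx a k) b a.
Proof.
rewrite /ricci_up mxE.
under eq_bigr do rewrite mxE mulr_suml; rewrite exchange_big /=.
apply: eq_bigr => a _; rewrite mxE; apply: eq_bigr => l _.
by rewrite mulrC -[in LHS]Gi_sym mxE.
Qed.

Lemma cov_mx_up i M : Gi *m cov_mx i M =
  d i (Gi *m M) + (Gi *m M) *m A i + (A i)^T *m (Gi *m M).
Proof. rewrite d_mulmx d_Gi /cov_mx; mx_ring. Qed.

Lemma cov_curv_up i j k b c : (Gi *m cov_curv i j k) b c =
  (Gi *m cov_mx i (curvature_mx j k)) b c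
  - \sum_l A i j l * (Gi *m curvature_mx l k) b c
  - \sum_l A i k l * (Gi *m curvature_mx j l) b c.
Proof.
rewrite /cov_curv !mulmxBr !mulmx_sumr !(addmxE, oppmxE) !summxE.
by congr (_ - _ - _); apply: eq_bigr => l _; rewrite -scalemxAr mxE.
Qed.

(** Covariant differentiation commutes with raising an index, hence preserves
    the antisymmetry of tensors with two upper indices. *)
Lemma cov_mx_up_antisym i M : (Gi *m M)^T = - (Gi *m M) ->
  (Gi *m cov_mx i M)^T = - (Gi *m cov_mx i M).
Proof.
move=> anti.
rewrite cov_mx_up !raddfD /= !trmx_mul -d_tr -trmx_mul anti d_oppmx trmxK.
mx_ring.
Qed.

Lemma cov_curv_antisym i j k b c :
  (Gi *m cov_curv i j k) b c = - (Gi *m cov_curv i j k) c b.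
Proof.
have anti (M : 'M[S]_n) : M^T = - M -> M b c = - M c b.
  by move=> e; rewrite -oppmxE -e mxE.
rewrite (cov_curv_up i j k b c) (cov_curv_up i j k c b).
have e := anti _ (cov_mx_up_antisym i (curvature_up_antisym j k)).
rewrite e {e}.
under eq_bigr do rewrite (anti _ (curvature_up_antisym _ _)) mulrN.
under [X in _ - X]eq_bigr do rewrite (anti _ (curvature_up_antisym _ _)) mulrN.
rewrite !sumrN; ring.
Qed.

Lemma cov_curvC i j k : cov_curv i k j = - cov_curv i j k.
Proof.
rewrite /cov_curv /cov_mx curvature_mxC d_oppmx.
under eq_bigr do rewrite curvature_mxC scalerN.
under [X in _ - X]eq_bigr do rewrite curvature_mxC scalerN.
rewrite !sumrN; mx_ring.
Qed.

(** Contraction commutes with covariant differentiation: the connection terms of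
    the two contracted indices cancel. *)
Lemma ricci_up_contract i k b :
  \sum_a (Gi *m cov_curv i a k) b a = cov_mx i ricci_up k b.
Proof.
rewrite /cov_mx !(addmxE, oppmxE) [(d i _) _ _]mxE ricci_upE raddf_sum.
have -> : (ricci_up *m A i) k b =
    \sum_a ((A i)^T *m (Gi *m curvature_mx a k)) b a.
  rewrite mxE; under eq_bigr do rewrite ricci_upE mulr_suml.
  rewrite exchange_big; apply: eq_bigr => a _; rewrite mxE.
  by apply: eq_bigr => l _; rewrite mulrC [(A i)^T _ _]mxE.
have -> : (A i *m ricci_up) k b =
    \sum_a \sum_l A i k l * (Gi *m curvature_mx a l) b a.
  rewrite mxE; under eq_bigr do rewrite ricci_upE mulr_sumr.
  exact: exchange_big.
have e : \sum_a ((Gi *m curvature_mx a k) *m A i) b a =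
    \sum_a \sum_l A i a l * (Gi *m curvature_mx l k) b a.
  under eq_bigr do rewrite mxE.
  rewrite exchange_big /=; apply: eq_bigr => l _.
  by apply: eq_bigr => a _; rewrite mulrC.
have ed : \sum_a D i ((Gi *m curvature_mx a k) b a) =
    \sum_a (d i (Gi *m curvature_mx a k)) b a.
  by apply: eq_bigr => a _; rewrite [RHS]mxE.
rewrite ed; under eq_bigr do rewrite cov_curv_up cov_mx_up !addmxE.
rewrite !(sumrB, big_split) /= e; ring.
Qed.

(** The commutator part of [cov_mx] has no trace. *)
Lemma D_tr i M : D i (\tr M) = \sum_k cov_mx i M k k.
Proof.
rewrite -/(\tr (cov_mx i M)) /cov_mx raddfB raddfD /=.
rewrite (mxtrace_mulC (A i)) addrK.
by rewrite /mxtrace raddf_sum; apply: eq_bigr => k _; rewrite [RHS]mxE.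
Qed.

(** Contract both pairs of indices in [second_bianchi].  The first of the three
    terms gives the derivative of the scalar curvature; the antisymmetry of the
    curvature in each of its two pairs of indices makes each of the other two
    minus the divergence of the Ricci tensor. *)
Lemma contracted_bianchi i :
  D i (\tr ricci_up) = (\sum_a cov_mx a ricci_up i a) *+ 2.
Proof.
have e2 : \sum_k \sum_a (Gi *m cov_curv a k i) k a =
    - \sum_a cov_mx a ricci_up i a.
  rewrite exchange_big -sumrN /=; apply: eq_bigr => a _.
  rewrite -ricci_up_contract -sumrN.
  by apply: eq_bigr => k _; rewrite [LHS]cov_curv_antisym.
have e3 : \sum_k \sum_a (Gi *m cov_curv k i a) k a =
    - \sum_k cov_mx k ricci_up i k.
  rewrite -sumrN; apply: eq_bigr => k _.
  rewrite -ricci_up_contract -sumrN.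
  by apply: eq_bigr => a _; rewrite cov_curvC mulmxN oppmxE.
have : \sum_k \sum_a (Gi *m (cov_curv i a k + cov_curv a k i
    + cov_curv k i a)) k a = 0.
  apply: big1 => k _; apply: big1 => a _.
  by rewrite second_bianchi mulmx0 mxE.
have distr (M N P : 'M[S]_n) k a : (Gi *m (M + N + P)) k a =
    (Gi *m M) k a + (Gi *m N) k a + (Gi *m P) k a.
  by rewrite !mulmxDr !addmxE.
under eq_bigr => k _ do under eq_bigr do rewrite distr.
under eq_bigr do rewrite !big_split /= ricci_up_contract.
rewrite !big_split /= e2 e3 -D_tr => /eqP.
by rewrite -addrA addr_eq0 opprD !opprK -mulr2n => /eqP.
Qed.

(** * Gradient, Hessian and divergence *)

Definition differential (f : S) : 'cV[S]_n := \col_a D a f.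

Definition gradient (f : S) : 'rV[S]_n := (differential f)^T *m Gi.

Definition hessian (f : S) : 'M[S]_n :=
  \matrix_(i, j) (D i (D j f) - \sum_k A i j k * D k f).

Definition hessian_up (f : S) : 'M[S]_n := hessian f *m Gi.

Definition cov_row i (w : 'rV[S]_n) : 'rV[S]_n := d i w + w *m A i.

Lemma cov_row_commute i j w :
  cov_row i (cov_row j w) - cov_row j (cov_row i w) = w *m curvature_mx i j.
Proof.
rewrite /cov_row /curvature_mx !(d_addmx, d_oppmx, d_mulmx) (d_comm j i).
mx_ring.
Qed.

Lemma cov_row_delta i j : cov_row i (delta_mx 0 j) = row j (A i).
Proof.
rewrite /cov_row -rowE (_ : d i _ = 0) ?add0r //.
by apply/rowP => k; rewrite !mxE Dnat.
Qed.

Lemma cov_row_gradient i f : cov_row i (gradient f) = row i (hessian_up f).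
Proof.
rewrite /cov_row /gradient d_mulmx d_Gi d_tr /hessian_up row_mul.
have -> : row i (hessian f) =
    (d i (differential f))^T - (differential f)^T *m (A i)^T.
  apply/rowP => j; rewrite !mxE; congr (_ - _); apply: eq_bigr => k _.
  by rewrite !mxE mulrC.
mx_ring.
Qed.

Definition divergence (M : 'M[S]_n) : 'cV[S]_n := \col_k \sum_a cov_mx a M k a.

Lemma divergenceD M N : divergence (M + N) = divergence M + divergence N.
Proof.
apply/colP => k; rewrite !mxE -big_split; apply: eq_bigr => a _ /=.
rewrite -addmxE; congr (fun_of_matrix _ _ _); rewrite /cov_mx d_addmx; mx_ring.
Qed.

Lemma divergence_sum m (M : 'I_m -> 'M[S]_n) :
  divergence (\sum_k M k) = \sum_k divergence (M k).
Proof.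
apply: (big_morph divergence divergenceD).
by apply: (@addrI _ (divergence 0)); rewrite -divergenceD !addr0.
Qed.

Lemma divergenceZ f M :
  divergence (f *: M) = M *m differential f + f *: divergence M.
Proof.
apply/colP => k; rewrite !mxE mulr_sumr -big_split; apply: eq_bigr => a _ /=.
rewrite /cov_mx -scalemxAl -scalemxAr !(addmxE, oppmxE) !mxE DM; ring.
Qed.

Lemma divergence1 : divergence 1%:M = 0.
Proof.
apply/colP => k; rewrite !mxE big1 // => a _.
by rewrite /cov_mx mul1mx mulmx1 d_scalar ?D1 // add0r subrr mxE.
Qed.

Lemma cov_mxE i M k b :
  cov_mx i M k b = cov_row i (row k M) 0 b - \sum_l A i k l * M l b.
Proof.
rewrite /cov_mx /cov_row !(addmxE, oppmxE) -row_mul.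
by congr (_ + _ - _); rewrite ?mxE.
Qed.

(** The Bochner formula: div H - d (tr H) is, in the k-th row, the trace over
    [a] of nabla_a nabla_k - nabla_k nabla_a applied to the gradient, hence by
    [cov_row_commute] a contraction of the curvature. *)
Lemma divergence_hessian f : divergence (hessian_up f) =
  ricci_up *m differential f + differential (\tr (hessian_up f)).
Proof.
apply/colP => k; rewrite addmxE [LHS]mxE [differential _ _ _ in RHS]mxE D_tr.
apply/eqP; rewrite -subr_eq -sumrB; apply/eqP.
transitivity (\sum_a (gradient f *m curvature_mx a k) 0 a).
  apply: eq_bigr => a _; rewrite !cov_mxE -!cov_row_gradient.
  rewrite -cov_row_commute [RHS]addmxE oppmxE.
  under eq_bigr do rewrite torsion_free.
  ring.
rewrite [RHS]mxE; under [RHS]eq_bigr do rewrite ricci_upE mulr_suml.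
rewrite exchange_big /=; apply: eq_bigr => a _.
rewrite /gradient -mulmxA mxE; apply: eq_bigr => b _.
by rewrite mulrC [_^T _ _]mxE.
Qed.

Definition grad_ip f g : S := (gradient f *m G *m (gradient g)^T) 0 0.

Lemma grad_ipC f g : grad_ip f g = grad_ip g f.
Proof.
rewrite /grad_ip; have e (M : 'M[S]_1) : M 0 0 = M^T 0 0 by rewrite mxE.
by rewrite [LHS]e trmx_mul (trmx_mul (gradient f)) trmxK G_sym mulmxA.
Qed.

Lemma cov_row_metric i (w z : 'rV[S]_n) : d i (w *m G *m z^T) =
  cov_row i w *m G *m z^T + (cov_row i z *m G *m w^T)^T.
Proof.
rewrite !d_mulmx metric_conn d_tr /cov_row !trmx_mul !raddfD /= !trmx_mul trmxK.
rewrite G_sym; mx_ring.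
Qed.

Lemma D_grad_ip i f g : D i (grad_ip f g) =
  (hessian_up f *m differential g) i 0 + (hessian_up g *m differential f) i 0.
Proof.
have low h k : row i (hessian_up h) *m G *m (gradient k)^T =
    row i (hessian_up h *m differential k).
  rewrite /gradient trmx_mul trmxK Gi_sym -mulmxA (mulmxA G) GGi mul1mx.
  by rewrite row_mul.
transitivity ((d i (gradient f *m G *m (gradient g)^T)) 0 0).
  by rewrite mxE.
by rewrite cov_row_metric !cov_row_gradient !low !mxE.
Qed.

(** * Consequence of the contracted Bianchi identity *)

(** Here [bi k] is 1 / b_k, and [lam] is a constant of the differential ring. *)
Lemma quasi_einstein_identity m (s : 'I_m -> nat) (lam : S)
    (b bi : 'I_m -> S) :
  (forall i, D i lam = 0) -> (forall k, b k * bi k = 1) ->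
  ricci_mx = lam *: G + \sum_k ((s k)%:R * bi k) *: hessian (b k) ->
  forall i, \sum_k (s k)%:R * bi k ^+ 2 *
    D i (\sum_j (s j)%:R * (b k * bi j) * grad_ip (b k) (b j)
         + b k * \tr (hessian_up (b k)) - grad_ip (b k) (b k)
         + lam * b k ^+ 2) = 0.
Proof.
move=> lam0 bK ricE i.
have ricci_up_sum : ricci_up = lam *: 1%:M
    + \sum_k ((s k)%:R * bi k) *: hessian_up (b k).
  rewrite /ricci_up ricE mulmxDl -scalemxAl GGi mulmx_suml.
  by congr (_ + _); apply: eq_bigr => k _; rewrite -scalemxAl.
have Dbi j k : D j (bi k) = - (bi k ^+ 2 * D j (b k)).
  have /eqP := congr1 (D j) (bK k); rewrite DM D1 addrC addr_eq0 => /eqP e.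
  by rewrite -[LHS]mul1r -(bK k) mulrAC e; ring.
pose t k := \tr (hessian_up (b k)).
pose p k j := (hessian_up (b k) *m differential (b j)) i 0.
have trE : D i (\tr ricci_up) =
    \sum_k (s k)%:R * (bi k * D i (t k) - bi k ^+ 2 * D i (b k) * t k).
  rewrite ricci_up_sum mxtraceD raddfD /= mxtraceZ DM lam0 mul0r mxtrace1 Dnat.
  rewrite mulr0 !add0r [\tr _]raddf_sum raddf_sum; apply: eq_bigr => k _ /=.
  rewrite mxtraceZ !DM Dnat Dbi /t; ring.
have divE : divergence ricci_up i 0 = \sum_k (s k)%:R * (bi k * D i (t k)
    + bi k * lam * D i (b k) - bi k ^+ 2 * p k k
    + \sum_j (s j)%:R * (bi k * bi j * p j k)).
  have diff_lam : differential lam = 0 by apply/colP => a; rewrite !mxE.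
  have diff_coef k : differential ((s k)%:R * bi k) =
      - ((s k)%:R * bi k ^+ 2) *: differential (b k).
    by apply/colP => a; rewrite !mxE DM Dnat Dbi; ring.
  have ricci_diff k : (ricci_up *m differential (b k)) i 0 =
      lam * D i (b k) + \sum_j ((s j)%:R * bi j) * p j k.
    rewrite ricci_up_sum mulmxDl -scalemxAl mul1mx mulmx_suml addmxE summxE.
    rewrite [X in X + _]mxE [differential _ _ _]mxE; congr (_ + _).
    by apply: eq_bigr => j _; rewrite -scalemxAl mxE.
  rewrite {1}ricci_up_sum divergenceD divergenceZ divergence1 diff_lam mulmx0.
  rewrite scaler0 !add0r divergence_sum summxE.
  apply: eq_bigr => k _; rewrite divergenceZ diff_coef -scalemxAr.
  rewrite divergence_hessian addmxE [X in X + _]mxE -/(p k k).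
  rewrite [X in _ + X]mxE addmxE ricci_diff.
  rewrite [differential _ _ _]mxE -/(t k).
  have -> : \sum_j (s j)%:R * (bi k * bi j * p j k) =
      bi k * \sum_j (s j)%:R * bi j * p j k.
    by rewrite mulr_sumr; apply: eq_bigr => j _; ring.
  ring.
(* The difference between the claim and the Bianchi identity: each summand is
   the value of [u] below at (k, j) minus its value at (j, k). *)
have T0 : \sum_k \sum_j (s k)%:R * ((s j)%:R *
    (bi k * bi j * (p k j - p j k) + grad_ip (b k) (b j) *
      (bi k ^+ 2 * bi j * D i (b k) - bi k * bi j ^+ 2 * D i (b j)))) = 0.
  pose u k j := (s k)%:R * (s j)%:R * (bi k * bi j * p k j
    + grad_ip (b k) (b j) * (bi k ^+ 2 * bi j * D i (b k))).
  transitivity (\sum_k \sum_j u k j - \sum_k \sum_j u j k).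
    rewrite -sumrB; apply: eq_bigr => k _; rewrite -sumrB.
    by apply: eq_bigr => j _; rewrite /u (grad_ipC (b j)); ring.
  by rewrite [X in _ - X]exchange_big subrr.
rewrite -[RHS](subrr (D i (\tr ricci_up))) {1}contracted_bianchi.
have -> : \sum_a cov_mx a ricci_up i a = divergence ricci_up i 0.
  by rewrite mxE.
rewrite divE trE -sumrMnl -sumrB.
set lhs := LHS; rewrite -[RHS]addr0; rewrite -[X in _ = _ + X]T0 -big_split.
rewrite {}/lhs; apply: eq_bigr => k _ /=; rewrite -!mulr_sumr.
rewrite raddfD raddfB raddfD /= raddf_sum /=.
have -> : \sum_j D i ((s j)%:R * (b k * bi j) * grad_ip (b k) (b j)) =
    \sum_j (s j)%:R * (b k * bi j * (p k j + p j k) + grad_ip (b k) (b j) *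
      (bi j * D i (b k) - b k * bi j ^+ 2 * D i (b j))).
  by apply: eq_bigr => j _; rewrite !DM Dnat Dbi D_grad_ip /p; ring.
have -> : \sum_j (s j)%:R *
    (b k * bi j * (p k j + p j k) + grad_ip (b k) (b j) *
      (bi j * D i (b k) - b k * bi j ^+ 2 * D i (b j))) =
  b k ^+ 2 * (\sum_j (s j)%:R * (bi k * bi j * (p k j - p j k)
    + grad_ip (b k) (b j) * (bi k ^+ 2 * bi j * D i (b k)
      - bi k * bi j ^+ 2 * D i (b j)))
    + (\sum_j (s j)%:R * (bi k * bi j * p j k)) *+ 2).
  rewrite -sumrMnl -big_split mulr_sumr; apply: eq_bigr => j _ /=.
  ring: (bK k) (bK j).
rewrite D_grad_ip !DM lam0 -/(t k) -/(p k k).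
ring: (bK k).
Qed.

End DifferentialRing.

(** * Directional derivatives of functions of several variables *)

Section DirectionalDerivatives.
Context {R : realType} {n : nat}.
Implicit Types (f : 'rV[R]_n -> R) (x y z u v w : 'rV[R]_n) (U : set 'rV[R]_n).

Lemma is_derive_line f y w (t : R) : derivable f (y + t *: w) w ->
  is_derive t (1 : R) (fun s : R => f (y + s *: w)) ('D_w f (y + t *: w)).
Proof.
have e : (fun h : R => h^-1 *: (((fun s : R => f (y + s *: w)) \o shift t)
    (h *: (1 : R)) - f (y + t *: w))) =
  (fun h : R => h^-1 *: ((f \o shift (y + t *: w)) (h *: w) - f (y + t *: w))).
  apply/funext => h /=; congr (_ *: (f _ - _)).
  by rewrite scalerDl [_%R *: 1]mulr1 addrCA.
by move=> df; split; rewrite /derivable /derive /= e.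
Qed.

Lemma mean_value_line f y w (h : R) :
  (forall t, `|t| <= `|h| -> derivable f (y + t *: w) w) ->
  exists2 c, `|c| <= `|h| &
    f (y + h *: w) - f y = h * 'D_w f (y + c *: w).
Proof.
move=> df.
pose phi (s : R) := f (y + s *: w).
have dphi s : `|s| <= `|h| -> is_derive s (1 : R) phi ('D_w f (y + s *: w)).
  by move=> /df; exact: is_derive_line.
have phi0 : f y = phi 0 by rewrite /phi scale0r addr0.
have [h0|h0] := leP 0 h.
- have H s : s \in `[0, h] -> `|s| <= `|h|.
    by rewrite in_itv /= => /andP[s0 sh]; rewrite !ger0_norm.
  have [||c /H ch e] :=
    @MVT_segment R phi (fun s => 'D_w f (y + s *: w)) 0 h h0.
  + by move=> s /subset_itv_oo_cc /H /dphi.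
  + by apply: derivable_within_continuous => s /H /dphi [].
  by exists c => //; rewrite phi0 -/(phi h) e subr0 mulrC.
- have H s : s \in `[h, 0] -> `|s| <= `|h|.
    rewrite in_itv /= => /andP[hs s0].
    by rewrite !ler0_norm ?(ltW h0) // lerN2.
  have [||c /H ch e] :=
    @MVT_segment R phi (fun s => 'D_w f (y + s *: w)) h 0 (ltW h0).
  + by move=> s /subset_itv_oo_cc /H /dphi.
  + by apply: derivable_within_continuous => s /H /dphi [].
  by exists c => //; rewrite phi0 -/(phi h) -opprB e sub0r mulrN opprK mulrC.
Qed.

(** Split the increment of [f] along h (u + c w) into its increments along h u
    and then along h c w.  The first is controlled by the derivative along [u]
    at [x]; the second, by the mean value theorem, is h c times a derivative
    along [w] at a point that tends to [x]. *)
Lemma is_derive_add f x u w (c a : R) : is_derive x u f a ->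
  (\forall y \near x, derivable f y w) -> {for x, continuous ('D_w f)} ->
  is_derive x (u + c *: w) f (a + c * 'D_w f x).
Proof.
move=> [du <-] dw cw; set b := 'D_w f x.
suff H : (fun h => h^-1 *: ((f \o shift x) (h *: (u + c *: w)) - f x)) @ 0^'
    --> 'D_u f x + c * b.
  by split; [apply/cvg_ex; eexists; exact: H | exact: cvg_lim H].
have -> : (fun h => h^-1 *: ((f \o shift x) (h *: (u + c *: w)) - f x)) =
  (fun h => h^-1 *: ((f \o shift x) (h *: u) - f x)) +
  (fun h => h^-1 * (f ((x + h *: u) + (h * c) *: w) - f (x + h *: u))).
  apply/funext => h; rewrite !fctE /= -[h^-1 * _]/(h^-1 *: _) -scalerDr.
  rewrite (scalerDr h) scalerA (addrC _ x) addrA (addrC (h *: u) x).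
  congr (_ *: _); ring.
apply: cvgD; first exact: du.
apply/cvgrPdist_le => e e0.
have e1 : 0 < e / (`|c| + 1) by rewrite divr_gt0 // ltr_pwDr.
move/cvgrPdist_le : (cw) => /(_ _ e1) cwe.
have : \forall y \near x, `|'D_w f x - 'D_w f y| <= e / (`|c| + 1) /\
    derivable f y w by apply: filterI.
move=> /nbhs_ballP[d /= d0 dball].
near=> h.
have hn0 : h != 0 by near: h; exact: nbhs_dnbhs_neq.
have small t : `|t| <= `|h * c| -> ball x d (x + h *: u + t *: w).
  move=> th; rewrite -ball_normE /ball_ /= !opprD !addrA subrr sub0r.
  rewrite -opprD normrN (le_lt_trans (ler_normD _ _)) // !normrZ.
  have : `|h| * (`|u| + `|c| * `|w|) < d.
    have hd : `|h| < d / (`|u| + `|c| * `|w| + 1).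
      near: h; apply: dnbhs0_lt.
      by rewrite divr_gt0 // ltr_pwDr // addr_ge0 // mulr_ge0.
    apply: le_lt_trans (_ : `|h| * (`|u| + `|c| * `|w| + 1) < d).
      by rewrite ler_wpM2l // lerDl.
    by rewrite -ltr_pdivlMr // ltr_pwDr // addr_ge0 // mulr_ge0.
  apply: le_lt_trans; rewrite mulrDr lerD2l mulrA -normrM.
  by rewrite ler_wpM2r.
have [t th ->] := @mean_value_line f (x + h *: u) w (h * c)
  (fun t th => (dball _ (small t th)).2).
rewrite mulrA mulrA mulVf // mul1r -mulrBr normrM.
have := (dball _ (small t th)).1 => /= Hb.
apply: le_trans (ler_wpM2l (normr_ge0 c) Hb) _.
rewrite mulrCA ler_piMr ?(ltW e0) // ler_pdivrMr ?ltr_pwDr //.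
by rewrite mul1r lerDl.
Unshelve. all: by end_near.
Qed.

(** The mean value theorem is applied along [a] to s |-> f (x + h b + s a) -
    f (x + s a), then along [b] to the derivative of [f] along [a]. *)
Lemma second_difference f x a b (d h : R) :
  (forall y, ball x d y -> derivable f y a) ->
  (forall y, ball x d y -> derivable ('D_a f) y b) ->
  0 <= h -> h * (`|a| + `|b|) < d ->
  exists2 z, ball x d z &
    f (x + h *: b + h *: a) - f (x + h *: a) - (f (x + h *: b) - f x) =
    h ^+ 2 * 'D_b ('D_a f) z.
Proof.
move=> fa fab h0 hd.
have inb s t : `|s| <= `|h| -> `|t| <= `|h| -> ball x d (x + s *: b + t *: a).
  move=> sh th; rewrite -ball_normE /ball_ /= !opprD !addrA subrr sub0r.
  rewrite -opprD normrN (le_lt_trans (ler_normD _ _)) // !normrZ.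
  rewrite (le_lt_trans _ hd) // mulrDr addrC lerD //;
  by rewrite ler_wpM2r // -[leRHS]ger0_norm.
pose phi (s : R) := f (x + h *: b + s *: a) - f (x + 0 *: b + s *: a).
pose dphi (s : R) :=
  'D_a f (x + h *: b + s *: a) - 'D_a f (x + 0 *: b + s *: a).
have hh : `|h| <= `|h| by [].
have zh : `|0 : R| <= `|h| by rewrite normr0.
have H s : s \in `[0, h] -> `|s| <= `|h|.
  by rewrite in_itv /= => /andP[s0 sh]; rewrite !ger0_norm.
have phiD s : s \in `[0, h] -> is_derive s (1 : R) phi (dphi s).
  by move=> /H sh; apply: is_deriveB; apply: is_derive_line;
    apply: fa; apply: inb.
have phi_c : {within `[0, h], continuous phi}.
  by apply: derivable_within_continuous => s /phiD [].
have [c /H ch e] := @MVT_segment R phi dphi 0 h h0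
  (fun s sh => phiD s (subset_itv_oo_cc sh)) phi_c.
have inb' t : `|t| <= `|h| -> ball x d (x + c *: a + t *: b).
  by move=> th; rewrite addrAC; exact: inb.
have [t th e'] := @mean_value_line ('D_a f) (x + c *: a) b h
  (fun t th => fab _ (inb' t th)).
exists (x + c *: a + t *: b); first exact: inb'.
move: e; rewrite /phi /dphi !scale0r !addr0 subr0 => ->.
by rewrite (addrAC x (h *: b)) e'; ring.
Qed.

(** Adding the coordinates of [v] one at a time, [is_derive_add] asks for
    continuity only of the partial derivatives. *)
Lemma is_derive_basis U f x v : open U -> U x -> Ck 1 U f ->
  is_derive x v f (\sum_a v 0 a * 'D_(basis_vec a) f x).
Proof.
move=> oU Ux [_ fC].
have {1}-> : v = \sum_a v 0 a *: basis_vec a :> 'rV[R]_n.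
  exact: row_sum_delta.
elim: (index_enum _) => [|a r IH].
  by rewrite !big_nil; exact: is_derive0.
rewrite !big_cons !(addrC (v 0 a * _)) (addrC (v 0 a *: _)).
apply: is_derive_add.
- apply: filterS (open_nbhs_nbhs (conj oU Ux)) => y Uy.
  exact: (fC a).1.
- by have [_ [H _]] := fC a; exact: H.
Qed.

(** The second difference of [f] is symmetric in [a] and [b]; divided by h ^ 2
    it is a value of either mixed derivative at a point close to [x]. *)
Lemma schwarz U f x a b : open U -> U x ->
  (forall y, U y -> derivable f y a) -> (forall y, U y -> derivable f y b) ->
  (forall y, U y -> derivable ('D_a f) y b) ->
  (forall y, U y -> derivable ('D_b f) y a) ->
  {for x, continuous ('D_b ('D_a f))} -> {for x, continuous ('D_a ('D_b f))} ->
  'D_b ('D_a f) x = 'D_a ('D_b f) x.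
Proof.
move=> oU Ux fa fb fab fba cab cba; apply/eqP; rewrite -subr_eq0 -normr_le0.
apply/ler_addgt0Pr => e e0; rewrite add0r.
have e2 : 0 < e / 2 by rewrite divr_gt0.
have : \forall y \near x, U y /\ (`|'D_b ('D_a f) x - 'D_b ('D_a f) y| <= e / 2
    /\ `|'D_a ('D_b f) x - 'D_a ('D_b f) y| <= e / 2).
  apply: filterI; first exact: open_nbhs_nbhs.
  apply: filterI; first by move/cvgrPdist_le : cab; apply.
  by move/cvgrPdist_le : cba; apply.
move=> /nbhs_ballP[d /= d0 dball].
pose K := `|a| + `|b|.
have K0 : 0 <= K by rewrite addr_ge0.
pose h := d / (K + 1).
have h0 : 0 < h by rewrite divr_gt0 // ltr_wpDl.
have hK : h * K < d.
  by rewrite mulrAC ltr_pdivrMr ?ltr_wpDl // ltr_pM2l // ltrDl.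
have inU y : ball x d y -> U y by move=> /dball [].
have [z zb ez] := second_difference (fun y yb => fa y (inU y yb))
  (fun y yb => fab y (inU y yb)) (ltW h0) hK.
have hK' : h * (`|b| + `|a|) < d by rewrite addrC.
have [z' zb' ez'] := second_difference (fun y yb => fb y (inU y yb))
  (fun y yb => fba y (inU y yb)) (ltW h0) hK'.
have {ez ez'} : h ^+ 2 * 'D_b ('D_a f) z = h ^+ 2 * 'D_a ('D_b f) z'.
  have swap (p q r t : R) : p - q - (r - t) = p - r - (q - t) by ring.
  by apply: etrans (esym ez) (etrans _ ez'); rewrite (addrAC x (h *: a)) swap.
move=> /(mulfI (lt0r_neq0 (exprn_gt0 2 h0))) ezz.
have [_ [zA _]] := dball _ zb; have [_ [_ zB]] := dball _ zb'.
rewrite ezz in zA.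
apply: le_trans (ler_distD ('D_a ('D_b f) z') _ _) _.
rewrite [leRHS]splitr; apply: lerD; first exact: zA.
by rewrite distrC; exact: zB.
Qed.

End DirectionalDerivatives.

(** * Closure properties of functions of class C^k *)

Section SmoothClosure.
Context {R : realType} {n : nat}.
Variables (U : set 'rV[R]_n) (oU : open U).

Let nearU x : U x -> \forall y \near x, U y.
Proof. by move=> Ux; exact: open_nbhs_nbhs. Qed.

Section Congruence.
Context {V : normedModType R}.
Implicit Types f g : 'rV[R]_n -> V.

Let near_eq f g x : (forall y, U y -> f y = g y) -> U x -> {near x, f =1 g}.
Proof. by move=> fg /nearU; apply: filterS => y /fg. Qed.

Lemma derive_eq_on f g x v : (forall y, U y -> f y = g y) -> U x ->
  'D_v f x = 'D_v g x.
Proof. by move=> fg Ux; apply: near_eq_derive; exact: near_eq. Qed.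

Let continuous_eq_on f g x : (forall y, U y -> f y = g y) -> U x ->
  {for x, continuous f} -> {for x, continuous g}.
Proof.
move=> fg Ux; rewrite /prop_for /continuous_at -(fg x Ux) => fx.
exact: cvg_trans (near_eq_cvg (near_eq fg Ux)) fx.
Qed.

Lemma Ck_eq_on k f g : (forall y, U y -> f y = g y) -> Ck k U f -> Ck k U g.
Proof.
elim: k f g => [|k IH] f g fg [fC fD];
  (split; first by move=> x Ux; exact: continuous_eq_on fg Ux (fC x Ux)) => //.
move=> a; have [fd fk] := fD a; split.
  by move=> x Ux; apply: near_eq_derivable (fd x Ux); exact: near_eq.
by apply: IH fk => y Uy; exact: derive_eq_on.
Qed.

Lemma Ck_le k f : Ck k.+1 U f -> Ck k U f.
Proof.
elim: k f => [|k IH] f [fC fD]; split=> // a.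
by have [fd /IH] := fD a.
Qed.

Lemma Ck_cst k (c : V) : Ck k U (cst c).
Proof.
elim: k c => [|k IH] c;
  (split; first by move=> x _; exact: cst_continuous) => //.
move=> a; split; first by move=> x _; exact: derivable_cst.
by apply: (@Ck_eq_on _ (cst 0)) => // y _; rewrite derive_cst.
Qed.

Lemma Ck_add k f g : Ck k U f -> Ck k U g -> Ck k U (f + g).
Proof.
elim: k f g => [|k IH] f g [fC fD] [gC gD].
  by split=> // x Ux; apply: continuousD; [exact: fC|exact: gC].
split=> [x Ux|a]; first by apply: continuousD; [exact: fC|exact: gC].
have [[fd fk] [gd gk]] := (fD a, gD a); split.
  by move=> x Ux; apply: derivableD; [exact: fd|exact: gd].
apply: (Ck_eq_on _ (IH _ _ fk gk)) => y Uy.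
by rewrite deriveD; [| exact: fd|exact: gd].
Qed.

End Congruence.

Implicit Types f g : 'rV[R]_n -> R.

Lemma Ck_mul k f g : Ck k U f -> Ck k U g -> Ck k U (f * g).
Proof.
elim: k f g => [|k IH] f g fk gk; have [fC fD] := fk; have [gC gD] := gk.
  by split=> // x Ux; apply: continuousM; [exact: fC|exact: gC].
split=> [x Ux|a]; first by apply: continuousM; [exact: fC|exact: gC].
have [[fd fDk] [gd gDk]] := (fD a, gD a); split.
  by move=> x Ux; apply: derivableM; [exact: fd|exact: gd].
apply: (Ck_eq_on _ (Ck_add (IH _ _ (Ck_le fk) gDk) (IH _ _ (Ck_le gk) fDk))).
by move=> y Uy; rewrite deriveM; [|exact: fd|exact: gd].
Qed.

Lemma Ck_opp k f : Ck k U f -> Ck k U (- f).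
Proof.
move=> fk; have ck : Ck k U (cst (-1) : 'rV[R]_n -> R) by exact: Ck_cst.
by apply: (Ck_eq_on _ (Ck_mul ck fk)) => y _; rewrite fctE mulN1r.
Qed.

Lemma Ck_inv k f : (forall x, U x -> f x != 0) -> Ck k U f ->
  Ck k U (fun x => (f x)^-1).
Proof.
move=> f0; elim: k => [|k IH] fk; have [fC fD] := fk.
  by split=> // x Ux; apply: continuousV; [exact: f0|exact: fC].
split=> [x Ux|a]; first by apply: continuousV; [exact: f0|exact: fC].
have [fd fDk] := fD a; split.
  by move=> x Ux; apply: derivableV; [exact: f0|exact: fd].
have ik := IH (Ck_le fk).
apply: (Ck_eq_on _ (Ck_opp (Ck_mul (Ck_mul ik ik) fDk))) => y Uy.
rewrite deriveV; [|exact: f0|exact: fd].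
by rewrite !fctE -[RHS]/(_ * _) mulNr expr2 invfM.
Qed.

Lemma Ck_entry k p q (M : 'rV[R]_n -> 'M[R]_(p, q)) i j :
  Ck k U M -> Ck k U (fun y => M y i j : R).
Proof.
have entry_continuous (N : 'rV[R]_n -> 'M[R]_(p, q)) x :
    {for x, continuous N} -> {for x, continuous (fun y => N y i j : R)}.
  move=> NC; apply: (@continuous_comp _ _ _ N (fun P : 'M[R]_(p, q) => P i j)).
    exact: NC.
  exact: coord_continuous.
elim: k M => [|k IH] M [MC MD].
  by split=> // x /MC; exact: entry_continuous.
split=> [x /MC|a]; first exact: entry_continuous.
have [Md Mk] := MD a; split.
  by move=> x Ux; apply: (derivable_mxP _ _ _).1; exact: Md.
apply: (Ck_eq_on _ (IH _ Mk)) => y Uy.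
by rewrite derive_mx ?mxE //; exact: Md.
Qed.

End SmoothClosure.

(** * The differential ring of smooth functions on an open set *)

(** The marked point serves to extend functions from the open set to the whole
    space, see [smooth_pred]. *)
Record region (R : realType) (n : nat) := Region {
  region_set :> set 'rV[R]_n;
  region_open : open region_set;
  region_pt : 'rV[R]_n;
  region_ptP : region_set region_pt }.

Arguments region_open {R n} r.

Section SmoothRing.
Context {R : realType} {n : nat}.
Variable U : region R n.

(** A smooth function on [U] is represented by its extension whose value outside
    [U] is its value at the marked point.  Such an extension is unique, and
    these functions form a subring of all functions on the whole space, which an
    extension by 0 would not give: it does not preserve the unit. *)
Definition smooth_pred : pred ('rV[R]_n -> R) := fun f =>
  `[< smooth_on U f /\ forall y, ~ region_set U y -> f y = f (region_pt U) >].

Lemma smooth_subring : subring_closed smooth_pred.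
Proof.
split=> [|f g /asboolP[fs fo] /asboolP[gs go]
         |f g /asboolP[fs fo] /asboolP[gs go]];
  apply/asboolP; split=> [k|y Uy] //.
- exact: (Ck_cst (region_open U) k (1 : R)).
- have oU := region_open U.
  exact: (Ck_add oU (fs k) (Ck_opp oU (gs k))).
- by rewrite !fctE fo // go.
- exact: (Ck_mul (region_open U) (fs k) (gs k)).
- by rewrite !fctE fo // go.
Qed.

HB.instance Definition _ :=
  GRing.isSubringClosed.Build _ smooth_pred smooth_subring.

Record smoothF := SmoothF {
  smoothF_val : 'rV[R]_n -> R;
  smoothF_valP : smoothF_val \in smooth_pred }.

HB.instance Definition _ := [isSub for smoothF_val].
HB.instance Definition _ := [Choice of smoothF by <:].
HB.instance Definition _ := [SubChoice_isSubComNzRing of smoothF by <:].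

Local Notation S := smoothF.
Implicit Types (f g : S) (y : 'rV[R]_n) (a : 'I_n).

Definition at_pt y (f : S) : R := \val f y.

Lemma at_pt_zmod y : zmod_morphism (at_pt y).
Proof. by move=> f g; rewrite /at_pt raddfB. Qed.

Lemma at_pt_monoid y : monoid_morphism (at_pt y).
Proof. by split=> [|f g]; rewrite /at_pt ?rmorph1 ?rmorphM. Qed.

HB.instance Definition _ y :=
  GRing.isZmodMorphism.Build S R (at_pt y) (at_pt_zmod y).
HB.instance Definition _ y :=
  GRing.isMonoidMorphism.Build S R (at_pt y) (at_pt_monoid y).

Lemma at_pt_smooth f : smooth_on U (at_pt^~ f).
Proof. by have /asboolP[] := smoothF_valP f. Qed.

Lemma smoothF_eq f g : (forall y, region_set U y -> at_pt y f = at_pt y g) ->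
  f = g.
Proof.
move=> fg; apply: val_inj; apply/funext => y.
have [Uy|nUy] := pselect (region_set U y); first exact: fg.
have [/asboolP[_ fo] /asboolP[_ go]] := (smoothF_valP f, smoothF_valP g).
by rewrite /= fo // go //; apply: fg; exact: region_ptP.
Qed.

Definition extend_cst (h : 'rV[R]_n -> R) y : R :=
  if `[< region_set U y >] then h y else h (region_pt U).

Lemma extend_cstE h y : region_set U y -> extend_cst h y = h y.
Proof. by rewrite /extend_cst => Uy; case: asboolP. Qed.

Lemma extend_cst_smooth h : smooth_on U h -> extend_cst h \in smooth_pred.
Proof.
move=> hs; apply/asboolP; split=> [k|y nUy].
  apply: (Ck_eq_on (region_open U) _ (hs k)) => y Uy.
  by rewrite extend_cstE.
rewrite [RHS]extend_cstE; last exact: region_ptP.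
by rewrite /extend_cst; case: asboolP.
Qed.

Definition smoothF_of h (hs : smooth_on U h) : S :=
  SmoothF (extend_cst_smooth hs).

Lemma smoothF_ofE h (hs : smooth_on U h) y : region_set U y ->
  at_pt y (smoothF_of hs) = h y.
Proof. exact: extend_cstE. Qed.

Lemma pder_smooth (h : 'rV[R]_n -> R) a :
  smooth_on U h -> smooth_on U ('D_(basis_vec a) h).
Proof. by move=> hs k; have [_ /(_ a)[]] := hs k.+1. Qed.

Definition pder a f : S := smoothF_of (pder_smooth a (at_pt_smooth f)).

Lemma pderE a f y : region_set U y ->
  at_pt y (pder a f) = 'D_(basis_vec a) (at_pt^~ f) y.
Proof. exact: smoothF_ofE. Qed.

Lemma at_pt_derivable f a y : region_set U y ->
  derivable (at_pt^~ f) y (basis_vec a).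
Proof. by move=> Uy; have [_ /(_ a)[/(_ y Uy)]] := at_pt_smooth f 1. Qed.

Lemma pder_zmod a : zmod_morphism (pder a).
Proof.
move=> f g; apply: smoothF_eq => y Uy; rewrite rmorphB /= !pderE //.
have -> : at_pt^~ (f - g) = at_pt^~ f - at_pt^~ g :> ('rV[R]_n -> R).
  by apply/funext => z; rewrite rmorphB.
by apply: deriveB; exact: at_pt_derivable.
Qed.

HB.instance Definition _ a :=
  GRing.isZmodMorphism.Build S S (pder a) (pder_zmod a).

Lemma pderM a f g :
  pder a (f * g) = pder a f * g + f * pder a g.
Proof.
apply: smoothF_eq => y Uy; rewrite rmorphD !rmorphM /= !pderE //.
have -> : at_pt^~ (f * g) = at_pt^~ f * at_pt^~ g :> ('rV[R]_n -> R).
  by apply/funext => z; rewrite rmorphM.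
rewrite addrC [X in _ = _ + X]mulrC.
by apply: deriveM; exact: at_pt_derivable.
Qed.

Lemma pderC a b f : pder a (pder b f) = pder b (pder a f).
Proof.
have eq_der c d y : region_set U y -> at_pt y (pder c (pder d f)) =
    'D_(basis_vec c) ('D_(basis_vec d) (at_pt^~ f)) y.
  move=> Uy; rewrite pderE //; apply: (derive_eq_on (region_open U)) => //.
  by move=> z Uz; rewrite pderE.
apply: smoothF_eq => y Uy; rewrite (eq_der a b y Uy) (eq_der b a y Uy).
have [_ fD] := at_pt_smooth f 2.
have [[fa [_ fDa]] [fb [_ fDb]]] := (fD a, fD b).
have [[fba [cba _]] [fab [cab _]]] := (fDa b, fDb a).
exact: (schwarz (region_open U) Uy fb fa fab fba (cab y Uy) (cba y Uy)).
Qed.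

Definition smooth_inv f (nz : forall y, region_set U y -> at_pt y f != 0) : S :=
  smoothF_of (fun k => Ck_inv (region_open U) nz (at_pt_smooth f k)).

Lemma mul_smooth_inv f nz : f * @smooth_inv f nz = 1.
Proof.
apply: smoothF_eq => y Uy; rewrite rmorphM rmorph1 /= smoothF_ofE //.
by rewrite mulfV //; exact: nz.
Qed.

Lemma derive_at_pt f v y : region_set U y ->
  'D_v (at_pt^~ f) y = \sum_a v 0 a * at_pt y (pder a f).
Proof.
move=> Uy.
have [_ ->] := is_derive_basis v (region_open U) Uy (at_pt_smooth f 1).
by apply: eq_bigr => a _; rewrite pderE.
Qed.

End SmoothRing.

(** * Smooth metrics as matrices over the ring of smooth functions *)

Section SmoothGeometry.
Context {R : realType} {n : nat}.
Variables (U : region R n) (Gm : 'rV[R]_n -> 'M[R]_n).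
Hypothesis Gm_smooth : smooth_on U Gm.
Hypothesis Gm_sym : forall y, region_set U y ->
  forall u v, loc_ip Gm y u v = loc_ip Gm y v u.
Hypothesis Gm_pos : forall y, region_set U y ->
  forall v, v != 0 -> 0 < loc_ip Gm y v v.

Local Notation S := (smoothF U).

(** The partial derivatives as additive maps, the form in which the derivations
    of a differential ring are given. *)
Definition apder (a : 'I_n) : {additive S -> S} := pder a.

Lemma cst_smooth (c : R) : smooth_on U (cst c : 'rV[R]_n -> R).
Proof. by move=> k; apply: Ck_cst; exact: region_open. Qed.

Definition const (c : R) : S := smoothF_of (@cst_smooth c).

Lemma constE c y : region_set U y -> at_pt y (const c) = c.
Proof. exact: smoothF_ofE. Qed.

Lemma apder_const a c : apder a (const c) = 0.
Proof.
apply: smoothF_eq => y Uy; rewrite /apder pderE // rmorph0.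
rewrite -[RHS](derive_cst c y (basis_vec a)).
by apply: (derive_eq_on (region_open U)) => // z Uz; rewrite constE.
Qed.

Lemma entry_smooth i j : smooth_on U (fun y => Gm y i j : R).
Proof. by move=> k; apply: Ck_entry; [exact: region_open|exact: Gm_smooth]. Qed.

Definition Gs : 'M[S]_n := \matrix_(i, j) smoothF_of (@entry_smooth i j).

Lemma map_Gs y : region_set U y -> map_mx (at_pt y) Gs = Gm y.
Proof. by move=> Uy; apply/matrixP => i j; rewrite !mxE smoothF_ofE. Qed.

Lemma at_Gs y i j : region_set U y -> at_pt y (Gs i j) = Gm y i j.
Proof. by move=> Uy; rewrite -(map_Gs Uy) [RHS]mxE. Qed.

Lemma loc_ip_basis y i j : loc_ip Gm y (basis_vec i) (basis_vec j) = Gm y i j.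
Proof. by rewrite /loc_ip -rowE trmx_delta -colE !mxE. Qed.

Lemma Gs_sym : Gs^T = Gs.
Proof.
apply/matrixP => i j; rewrite mxE; apply: smoothF_eq => y Uy.
by rewrite !at_Gs // -(loc_ip_basis y i j) -(loc_ip_basis y j i) Gm_sym.
Qed.

Lemma GsC i j : Gs i j = Gs j i.
Proof. by rewrite -[in LHS]Gs_sym mxE. Qed.

(** A row killed by [Gm y] has length 0. *)
Lemma Gm_unit y : region_set U y -> Gm y \in unitmx.
Proof.
move=> Uy; rewrite -row_free_unit -kermx_eq0; apply/rowV0P => v.
move=> /sub_kermxP vG; apply/eqP/negPn/negP => /(Gm_pos Uy).
by rewrite /loc_ip vG mul0mx mxE ltxx.
Qed.

Lemma det_Gs_neq0 y : region_set U y -> at_pt y (\det Gs) != 0.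
Proof.
by move=> Uy; rewrite -det_map_mx /= map_Gs // -unitfE; exact: Gm_unit.
Qed.

(** The inverse of [Gs], by Cramer's rule. *)
Definition Gis : 'M[S]_n := smooth_inv det_Gs_neq0 *: \adj Gs.

Lemma GGis : Gs *m Gis = 1%:M.
Proof.
by rewrite -scalemxAr mul_mx_adj scale_scalar_mx mulrC mul_smooth_inv.
Qed.

Lemma GisG : Gis *m Gs = 1%:M.
Proof.
by rewrite -scalemxAl mul_adj_mx scale_scalar_mx mulrC mul_smooth_inv.
Qed.

Lemma GisC i j : Gis i j = Gis j i.
Proof. by rewrite -[in LHS](Gi_sym Gs_sym GGis) mxE. Qed.

Lemma map_Gis y : region_set U y -> map_mx (at_pt y) Gis = invmx (Gm y).
Proof.
move=> Uy; have := congr1 (map_mx (at_pt y)) GGis.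
rewrite map_mxM map_mx1 map_Gs // => e.
by rewrite -[LHS]mul1mx -(mulVmx (Gm_unit Uy)) -mulmxA e mulmx1.
Qed.

Lemma at_Gis y i j : region_set U y -> at_pt y (Gis i j) = invmx (Gm y) i j.
Proof. by move=> Uy; rewrite -(map_Gis Uy) [RHS]mxE. Qed.

(** Twice the Christoffel symbols of the first kind. *)
Definition christoffel1 i : 'M[S]_n :=
  \matrix_(j, l) (apder i (Gs j l) + apder j (Gs i l) - apder l (Gs i j)).

Definition conn i : 'M[S]_n := const 2^-1 *: (christoffel1 i *m Gis^T).

Lemma christoffel1E i j l :
  christoffel1 i j l = apder i (Gs j l) + apder j (Gs i l) - apder l (Gs i j).
Proof. by rewrite [LHS]mxE. Qed.

Lemma connE i j k : conn i j k =
  const 2^-1 * \sum_l Gis k l *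
    (apder i (Gs j l) + apder j (Gs i l) - apder l (Gs i j)).
Proof.
rewrite /conn 2!mxE; congr (_ * _); apply: eq_bigr => l _.
by rewrite christoffel1E mulrC [Gis^T _ _]mxE.
Qed.

Lemma conn_torsion_free i j k : conn i j k = conn j i k.
Proof.
rewrite !connE; congr (_ * _); apply: eq_bigr => l _.
by rewrite (GsC i j) (addrC (apder i _)).
Qed.

Lemma const2 : const 2^-1 *+ 2 = 1.
Proof.
apply: smoothF_eq => y Uy; rewrite rmorphMn rmorph1 /= constE //.
by rewrite -mulr_natr mulVf.
Qed.

Lemma conn_metric i :
  map_mx (apder i) Gs = conn i *m Gs + Gs *m (conn i)^T.
Proof.
have e : conn i *m Gs = const 2^-1 *: christoffel1 i.
  rewrite /conn -scalemxAl -mulmxA -[X in _ *m (_ *m X)]Gs_sym -trmx_mul.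
  by rewrite GGis trmx1 mulmx1.
have -> : Gs *m (conn i)^T = (conn i *m Gs)^T by rewrite trmx_mul Gs_sym.
rewrite e; apply/matrixP => j l.
have eE a b : (const 2^-1 *: christoffel1 i) a b =
  const 2^-1 * christoffel1 i a b by rewrite mxE.
rewrite [LHS]mxE addmxE [_^T _ _]mxE !eE !christoffel1E.
rewrite (GsC l j) (GsC i l) (GsC i j) -[LHS]mul1r -const2; ring.
Qed.

Lemma at_apder y a (f : S) (h : 'rV[R]_n -> R) : region_set U y ->
  (forall z, region_set U z -> at_pt z f = h z) ->
  at_pt y (apder a f) = 'D_(basis_vec a) h y.
Proof.
move=> Uy fh; rewrite pderE //.
exact: (derive_eq_on (region_open U)).
Qed.

Lemma at_conn y i j k : region_set U y ->
  at_pt y (conn i j k) = christoffel Gm y i j k.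
Proof.
move=> Uy; rewrite connE rmorphM rmorph_sum /= constE // mulr_sumr.
rewrite /christoffel mulr_sumr; apply: eq_bigr => l _.
rewrite rmorphM rmorphB rmorphD /= at_Gis //.
by congr (_ * (_ * (_ + _ - _))); apply: at_apder => // z; exact: at_Gs.
Qed.

Definition represents (W : 'rV[S]_n) (Y : 'rV[R]_n -> 'rV[R]_n) :=
  forall z, region_set U z -> Y z = map_mx (at_pt z) W.

Lemma represents_basis l : represents (delta_mx 0 l) (cst (basis_vec l)).
Proof. by move=> z Uz; rewrite map_delta_mx. Qed.

Lemma represents_nabla i W Y : represents W Y ->
  represents (cov_row apder conn i W) (nabla Gm (cst (basis_vec i)) Y).
Proof.
move=> WY y Uy; rewrite /nabla /cst; apply/rowP => k.
have Yk z j : region_set U z -> Y z 0 j = at_pt z (W 0 j).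
  by move=> Uz; rewrite WY // mxE.
have Yd : derivable Y y (basis_vec i).
  apply/derivable_mxP => a b; rewrite ord1.
  have := @at_pt_derivable R n U (W 0 b) i y Uy.
  apply: near_eq_derivable.
  apply: filterS (open_nbhs_nbhs (conj (region_open U) Uy)).
  by move=> z Uz; rewrite Yk.
rewrite /cov_row addmxE [RHS]mxE [X in at_pt _ X]addmxE rmorphD derive_mx //=.
congr (_ + _).
  rewrite mxE [X in at_pt _ X]mxE; apply: esym; apply: at_apder => // z Uz.
  by rewrite Yk.
rewrite mxE [X in at_pt _ X]mxE rmorph_sum (bigD1 i) //= [X in _ + X]big1.
  rewrite addr0; apply: eq_bigr => j _.
  by rewrite mxE !eqxx mul1r rmorphM /= at_conn // Yk.
move=> i' /negPf ne; apply: big1 => j _.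
by rewrite mxE ne andbF !mul0r.
Qed.

(** Coordinate fields commute, so the bracket term of the curvature vanishes and
    [cov_row_commute] applies. *)
Lemma at_ricci y k l : region_set U y ->
  loc_ricci Gm y (basis_vec k) (basis_vec l) =
  at_pt y (ricci_mx apder conn k l).
Proof.
move=> Uy; rewrite /loc_ricci [ricci_mx apder conn k l]mxE rmorph_sum.
apply: eq_bigr => a _ /=.
have rep i j : represents
   (cov_row apder conn i (cov_row apder conn j (delta_mx 0 l)))
   (nabla Gm (cst (basis_vec i))
     (nabla Gm (cst (basis_vec j)) (cst (basis_vec l)))).
  by do 2 apply: represents_nabla; exact: represents_basis.
rewrite /curvature !rep // -map_mxB.
have -> : nabla Gm (lie_bracket (cst (basis_vec a)) (cst (basis_vec k)))
    (cst (basis_vec l)) y = 0.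
  rewrite /nabla /lie_bracket !derive_cst subrr add0r.
  apply/rowP => b; rewrite !mxE; apply: big1 => i _; apply: big1 => j _.
  by rewrite mxE !mul0r.
rewrite subr0 cov_row_commute; [|exact: pderM|exact: pderC].
by rewrite mxE -rowE mxE.
Qed.

Lemma at_gradient y (F : S) h :
  (forall z, region_set U z -> h z = at_pt z F) -> region_set U y ->
  loc_grad Gm h y = map_mx (at_pt y) (gradient apder Gis F).
Proof.
move=> hF Uy; rewrite /loc_grad /gradient map_mxM /= map_Gis //; congr (_ *m _).
apply/rowP => a; rewrite [RHS]mxE [X in at_pt _ X]mxE.
rewrite [differential _ _ _ _]mxE mxE.
by apply: esym; apply: at_apder => // z Uz; rewrite hF.
Qed.

Lemma at_grad_ip y (F H : S) : region_set U y ->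
  loc_ip Gm y (map_mx (at_pt y) (gradient apder Gis F))
    (map_mx (at_pt y) (gradient apder Gis H)) =
  at_pt y (grad_ip apder Gs Gis F H).
Proof.
by move=> Uy; rewrite /loc_ip -(map_Gs Uy) map_trmx -!map_mxM mxE.
Qed.

Lemma at_hessian y (F : S) h i j :
  (forall z, region_set U z -> h z = at_pt z F) -> region_set U y ->
  loc_hess Gm h y (basis_vec i) (basis_vec j) =
  at_pt y (hessian apder conn F i j).
Proof.
move=> hF Uy; rewrite /loc_hess /vf_apply [hessian _ _ _ _ _]mxE rmorphB.
congr (_ - _).
  apply: esym; apply: at_apder => // z Uz; apply: at_apder => // w Uw.
  by rewrite hF.
rewrite (derive_eq_on (region_open U) _ hF Uy) derive_at_pt //.
rewrite rmorph_sum; apply: eq_bigr => k _; rewrite rmorphM; congr (_ * _).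
rewrite (represents_nabla i (represents_basis j) Uy) cov_row_delta ?mxE //.
exact: pderM.
Qed.

Lemma at_laplacian y (F : S) h :
  (forall z, region_set U z -> h z = at_pt z F) -> region_set U y ->
  loc_laplacian Gm h y = at_pt y (\tr (hessian_up apder Gis conn F)).
Proof.
move=> hF Uy; rewrite /loc_laplacian /mxtrace rmorph_sum; apply: eq_bigr => i _.
rewrite [X in _ = _ X]mxE rmorph_sum; apply: eq_bigr => j _ /=.
by rewrite (at_hessian _ _ hF Uy) -at_Gis // rmorphM GisC mulrC.
Qed.

(** * The identity on an open set of R^n and on a manifold *)

Lemma local_identity m (s : 'I_m -> nat) (lambda : R)
    (b : 'I_m -> 'rV[R]_n -> R) :
  (forall k, smooth_on U (b k)) ->
  (forall k y, region_set U y -> b k y != 0) ->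
  (forall y, region_set U y -> forall u v, loc_ricci Gm y u v =
    lambda * loc_ip Gm y u v +
    \sum_k (s k)%:R / b k y * loc_hess Gm (b k) y u v) ->
  forall y, region_set U y -> forall v,
  \sum_(k < m) (s k)%:R / (2 * b k y ^+ 2) *
    'D_v (fun z =>
      \sum_(j < m) (s j)%:R * (b k z / b j z) *
        loc_ip Gm z (loc_grad Gm (b k) z) (loc_grad Gm (b j) z)
      + b k z * loc_laplacian Gm (b k) z
      - loc_ip Gm z (loc_grad Gm (b k) z) (loc_grad Gm (b k) z)
      + lambda * b k z ^+ 2) y = 0.
Proof.
move=> b_smooth b_neq0 ricE y Uy v.
pose B k : S := smoothF_of (b_smooth k).
have BE k z : region_set U z -> at_pt z (B k) = b k z by exact: smoothF_ofE.
have B_neq0 k z : region_set U z -> at_pt z (B k) != 0.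
  by move=> Uz; rewrite BE //; exact: b_neq0.
pose Bi k : S := smooth_inv (B_neq0 k).
have BBi k : B k * Bi k = 1 by exact: mul_smooth_inv.
have BiE k z : region_set U z -> at_pt z (Bi k) = (b k z)^-1.
  by move=> Uz; rewrite smoothF_ofE // BE.
have ricS : ricci_mx apder conn =
    const lambda *: Gs + \sum_k ((s k)%:R * Bi k) *: hessian apder conn (B k).
  apply/matrixP => i j; apply: smoothF_eq => z Uz.
  have scaleE (x : S) (M : 'M[S]_n) : (x *: M) i j = x * M i j by rewrite mxE.
  rewrite -at_ricci // ricE // loc_ip_basis addmxE scaleE.
  rewrite summxE rmorphD rmorphM rmorph_sum /= constE // at_Gs //.
  congr (_ + _); apply: eq_bigr => k _.
  rewrite scaleE !rmorphM rmorph_nat /= BiE //; congr (_ * _).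
  by apply: at_hessian => // w Uw; rewrite BE.
pose Phi k : S :=
  \sum_j (s j)%:R * (B k * Bi j) * grad_ip apder Gs Gis (B k) (B j)
  + B k * \tr (hessian_up apder Gis conn (B k))
  - grad_ip apder Gs Gis (B k) (B k)
  + const lambda * B k ^+ 2.
have PhiE k z : region_set U z ->
  \sum_(j < m) (s j)%:R * (b k z / b j z) *
        loc_ip Gm z (loc_grad Gm (b k) z) (loc_grad Gm (b j) z)
      + b k z * loc_laplacian Gm (b k) z
      - loc_ip Gm z (loc_grad Gm (b k) z) (loc_grad Gm (b k) z)
      + lambda * b k z ^+ 2 = at_pt z (Phi k).
  move=> Uz; have bB j w : region_set U w -> b j w = at_pt w (B j).
    by move=> Uw; rewrite BE.
  rewrite (at_gradient (bB k) Uz) at_grad_ip // (at_laplacian (bB k) Uz).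
  rewrite rmorphD rmorphB rmorphD !rmorphM /= constE // BE //.
  congr (_ + _ - _ + _); rewrite rmorph_sum; apply: eq_bigr => j _.
  rewrite (at_gradient (bB j) Uz) at_grad_ip // !rmorphM rmorph_nat /=.
  by rewrite BE // BiE.
under eq_bigr => k _.
  rewrite (derive_eq_on (region_open U) v (PhiE k) Uy) derive_at_pt //.
  over.
have key := quasi_einstein_identity (@pderM R n U) (@pderC R n U)
  Gs_sym GGis GisG conn_torsion_free conn_metric
  (fun i => apder_const i lambda) BBi ricS.
transitivity (\sum_a v 0 a / 2 *
    at_pt y (\sum_k (s k)%:R * Bi k ^+ 2 * apder a (Phi k))).
  under [RHS]eq_bigr do rewrite rmorph_sum mulr_sumr.
  rewrite [RHS]exchange_big; apply: eq_bigr => k _; rewrite mulr_sumr.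
  apply: eq_bigr => a _ /=; rewrite !rmorphM rmorph_nat /= !BiE //.
  rewrite expr2 !invfM; ring.
by apply: big1 => a _; rewrite key rmorph0 mulr0.
Qed.

End SmoothGeometry.

Theorem theorem1p1 (R : realType) (n : nat) (hn : (2 <= n)%N)
  (B : smoothManifold R n) (g : riemannianMetric B)
  (hB : compact [set: B])
  (m : nat) (hm : (1 <= m)%N)
  (s : 'I_m -> nat) (hs : forall i, (0 < s i)%N)
  (lambda : R) (b : 'I_m -> B -> R)
  (b_smooth : forall i, smooth_fun (b i))
  (b_pos : forall i p, 0 < b i p)
  (b_nonconst : forall i, ~ exists a : R, forall p, b i p = a)
  (hRic : forall c : chart R n B, atlas c -> forall p, chart_dom c p ->
    forall u v : 'rV[R]_n,
    ricci g c p u v =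
    lambda * inner g c p u v +
    \sum_(i < m) (s i)%:R / b i p * hess g c (b i) p u v) :
  forall c : chart R n B, atlas c -> forall p, chart_dom c p ->
  forall v : 'rV[R]_n,
  \sum_(k < m) (s k)%:R / (2 * b k p ^+ 2) *
    ext_d c (fun q : B =>
      \sum_(j < m) (s j)%:R * (b k q / b j q) *
        inner g c q (grad g c (b k) q) (grad g c (b j) q)
      + b k q * laplacian g c (b k) q
      - inner g c q (grad g c (b k) q) (grad g c (b k) q)
      + lambda * b k q ^+ 2) p v = 0.
Proof.
move=> c ac p cp v.
have Uy : chart_img c (c p) by exists p.
pose U := Region (@chart_img_open R n B c) Uy.
have cK y : region_set U y -> c (chart_inv c y) = y.
  by move=> [q cq <-]; rewrite chart_mapK.
have dom y : region_set U y -> chart_dom c (chart_inv c y).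
  by move=> [q cq <-]; rewrite chart_mapK.
have := @local_identity R n U (g c) (@metric_smooth R n B g c ac)
  (@Defs.metric_sym R n B g c ac) (@metric_pos R n B g c ac)
  m s lambda (fun k => b k \o chart_inv c) (fun k => b_smooth k c ac)
  (fun k y _ => lt0r_neq0 (b_pos k _)) _ (c p) Uy v.
rewrite /= chart_mapK // => H; rewrite -[RHS]H => {H}; last first.
  move=> y yU u w; have := hRic c ac _ (dom y yU) u w.
  by rewrite /ricci /inner /hess cK.
apply: eq_bigr => k _; congr (_ * _); rewrite /ext_d.
apply: (derive_eq_on (region_open U)) => // y yU.
by rewrite /= /inner /grad /laplacian cK.
Qed.
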